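(* Let $X$ be an open subspace of a $\Pi$-pseudo-metric space. Then: (1) $X$ is a Baire space if and only if $X$ is an $\mathcal{N}$-space. (2) $X$ is non-meager in itself if and only if $X$ is a g$\mathcal{N}$-space.
   Context: ''Compact'' means every open cover has a finite subcover (not necessarily Hausdorff). A $\Pi$-pseudo-metric space is a space homeomorphic to the product of a family of pseudo-metric spaces. A set is meager if it is a countable union of sets whose closures have empty interior; $X$ is Baire if no non-void open subset is meager in $X$. $X$ is an $\mathcal{N}$-space if for every compact space $Y$ and every separately continuous $f\colon X\times Y\to\mathbb{R}$ there is a dense set $R\subseteq X$ such that $f$ is jointly continuous at each point of $R\times Y$. $X$ is a g$\mathcal{N}$-space if for every compact space $Y$ and every separately continuous $f\colon X\times Y\to\mathbb{R}$ there is at least one point $x\in X$ such that $f$ is jointly continuous at each point of $\{x\}\times Y$. *)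

(* Defs.v *)
From mathcomp Require Import all_boot all_order all_algebra.
From mathcomp Require Import all_classical all_reals all_analysis.
Import Order.TTheory GRing.Theory Num.Theory.
Import numFieldNormedType.Exports.

Set Implicit Arguments.
Unset Strict Implicit.
Unset Printing Implicit Defensive.

Local Open Scope classical_set_scope.
Local Open Scope ring_scope.

Definition homeomorphic (S T : topologicalType) : Prop :=
  exists (f : S -> T) (g : T -> S),
    [/\ cancel f g, cancel g f, continuous f & continuous g].

(* [pseudoMetricType R] presents a pseudo-metric by its balls; the distance it
   induces may be infinite, which does not enlarge the class of topologies
   (truncate the distance at 1). The index type [I] is arbitrary. *)
Definition Pi_pseudo_metric_space (R : realType) (P : topologicalType) : Prop :=
  exists (I : Type) (M : I -> pseudoMetricType R),
    homeomorphic P (prod_topology (fun i => M i : topologicalType)).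

Definition nowhere_dense (T : topologicalType) (A : set T) : Prop :=
  interior (closure A) = set0.

Definition meager (T : topologicalType) (A : set T) : Prop :=
  exists2 F : nat -> set T,
    (forall n, nowhere_dense (F n)) & A = \bigcup_n F n.

Definition Baire_space (T : topologicalType) : Prop :=
  forall O : set T, open O -> O !=set0 -> ~ meager O.

(* [cover_compact] is compactness by open covers; the filter-based [compact] is
   proved equivalent to it in the library only for pointed spaces, and [Y] is
   allowed to be empty here. *)
Definition compact_space (Y : topologicalType) : Prop :=
  cover_compact [set: Y].

Definition separately_continuous (R : realType) (X Y : topologicalType)
    (f : X * Y -> R) : Prop :=
  (forall y, continuous (fun x => f (x, y))) /\
  (forall x, continuous (fun y => f (x, y))).

Definition N_space (R : realType) (X : topologicalType) : Prop :=
  forall Y : topologicalType, compact_space Y ->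
  forall f : X * Y -> R, separately_continuous f ->
  exists2 D : set X, dense D &
    forall x y, D x -> {for (x, y), continuous f}.

Definition gN_space (R : realType) (X : topologicalType) : Prop :=
  forall Y : topologicalType, compact_space Y ->
  forall f : X * Y -> R, separately_continuous f ->
  exists x : X, forall y, {for (x, y), continuous f}.

(* Main.v *)
Require Import Defs.
From mathcomp Require Import all_boot all_order all_algebra finmap.
From mathcomp Require Import ring lra.
From mathcomp Require Import all_classical all_reals all_analysis.
Import Order.TTheory GRing.Theory Num.Theory.
Import numFieldNormedType.Exports.
Set Implicit Arguments.
Unset Strict Implicit.
Unset Printing Implicit Defensive.
Local Open Scope classical_set_scope.
Local Open Scope ring_scope.

(** Call [X] the space of the theorem, with [e] its open embedding in a product
of pseudo-metric spaces.

Continuity from category. For [f] separately continuous on [X * Y], with [Y]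
compact, the points [x] such that [f] is not jointly continuous at some
[(x, y)] form a meager set ([discontinuities_meager]); this settles both
forward implications at once. Such an [x] is not in the open set
[small_osc f eps] for some [eps], so it suffices that the interior [D] of the
closed set [~` small_osc f eps] is meager. This is a Banach-Mazur game. Inside
any non-empty open part of [D], compactness of [Y] yields [y], [z] that finitely
many given points [a_0], ..., [a_(n-1)] almost fail to distinguish, although
[|f (x, y) - f (x, z)|] stays large for [x] in some smaller open set
([separating_pair]). Shrink the latter to a box depending on finitely many
coordinates, centred at a point [a_n] which agrees with a base point [b] off
these coordinates, the radii going to 0. If a point [p] survived all moves, the
point [q] equal to [p] on the coordinates ever used and to [b] elsewhere would
lie in all the boxes, and [a_n] would converge to [q]: this is what
the base point is for, as nothing else controls the unused coordinates. At a
cluster point [(y, z)] of the chosen pairs, [f (a_n, y) = f (a_n, z)] for all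
[n], hence [f (q, y) = f (q, z)] in the limit, whereas [f (q, y)] and
[f (q, z)] stay apart ([no_infinite_play]). So no point survives, and
[meager_no_play] (the Oxtoby argument, by a tree of maximal disjoint families)
turns this into meagerness of [D].

Discontinuity on a meager set. Given nowhere dense sets [F_n] in a completely
regular space, choose for each [n] a maximal family of continuous functions
[u_(n, j)] with values in [[0, 1]], vanishing on [F_n], with pairwise disjoint
supports; by maximality the union of the supports is dense. Let [Y] be the
compact space of the [y] in the cube indexed by the pairs [(n, j)] that have at
most one non-zero coordinate. On [X * Y] put
[f (x, y) = ratio (y_(n, j)) (u_(n, j) x) / (n + 1)], where [(n, j)] is the
non-zero coordinate of [y], [f (x, 0) = 0], and
[ratio s t = s * t / (s ^ 2 + t ^ 2)] is the classical separately continuous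
function that is discontinuous at the origin. Then [f] is separately
continuous and is discontinuous at [(x, 0)] for every [x] in some [F_n]
([meager_discontinuities]); hence a meager non-empty open set contradicts the
N-property, and a meager [X] the gN-property. *)

(** * Nowhere dense and meager sets *)

Section Category.
Context {T : topologicalType}.
Implicit Types A B O : set T.

Lemma nowhere_denseP A : nowhere_dense A <->
  forall O, open O -> O !=set0 ->
    exists2 O', open O' & [/\ O' !=set0, O' `<=` O & O' `&` A = set0].
Proof.
split=> [A0 O oO [x Ox]|H].
  have [z [Oz nz]] : exists z, O z /\ ~ closure A z.
    apply: contrapT => h; suff : interior (closure A) x by rewrite A0.
    apply: filterS (open_nbhs_nbhs (conj oO Ox)) => z Oz; apply: contrapT => nz.
    by apply: h; exists z.
  exists (O `&` ~` closure A).
    by apply: openI => //; apply: closed_openC; exact: closed_closure.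
  split; [by exists z|exact: subIsetl|].
  by rewrite -subset0 => t [[_ nt] At]; apply: nt; exact: subset_closure.
rewrite /nowhere_dense -subset0 => x Ax.
have [||O' oO' [[z O'z] sO' O'A]] := H (closure A)°.
  exact: open_interior.
  by exists x.
have /(_ O') := interior_subset (sO' _ O'z).
case; first exact: open_nbhs_nbhs.
by move=> t [At O't]; suff : set0 t by []; rewrite -O'A.
Qed.

Lemma sub_nowhere_dense A B : A `<=` B -> nowhere_dense B -> nowhere_dense A.
Proof.
move=> AB B0; rewrite /nowhere_dense -subset0 -B0.
exact/interiorS/closureS.
Qed.

Lemma sub_meager A B : A `<=` B -> meager B -> meager A.
Proof.
move=> AB [F F0 BF]; exists (fun n => A `&` F n).
  by move=> n; apply: sub_nowhere_dense (F0 n); exact: subIsetr.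
by rewrite -setI_bigcupr -BF; apply/esym/setIidPl.
Qed.

Lemma nowhere_dense_meager A : nowhere_dense A -> meager A.
Proof. by move=> A0; exists (fun=> A) => //; rewrite bigcup_const. Qed.

Lemma bigcup_meager (F : nat -> set T) :
  (forall n, meager (F n)) -> meager (\bigcup_n F n).
Proof.
move=> mF.
have /choice[G HG] : forall n, exists G : nat -> set T,
    (forall m, nowhere_dense (G m)) /\ F n = \bigcup_m G m.
  by move=> n; have [G ? ?] := mF n; exists G.
exists (fun k => if @choice.unpickle (nat * nat)%type k is Some nm
                 then G nm.1 nm.2 else set0).
  move=> k; case: (choice.unpickle k) => [[n m]|]; first exact: (HG n).1.
  by rewrite /nowhere_dense closure0 interior0.
apply/seteqP; split=> x.
  move=> [n _]; rewrite (HG n).2 => -[m _ Gx].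
  by exists (choice.pickle (n, m)) => //; rewrite choice.pickleK.
move=> [k _]; case: (choice.unpickle k) => [[n m] Gx|//].
by exists n => //; rewrite (HG n).2; exists m.
Qed.

Lemma setU_meager A B : meager A -> meager B -> meager (A `|` B).
Proof.
move=> mA mB; rewrite -bigcup2E; apply: bigcup_meager => -[|[|n]] //=.
by apply: nowhere_dense_meager; rewrite /nowhere_dense closure0 interior0.
Qed.

(** The boundary of a closed set is nowhere dense, so it does not count. *)
Lemma closed_meager_interior A : closed A -> meager A° -> meager A.
Proof.
move=> cA mA; apply: (@sub_meager _ (A° `|` (A `\` A°))).
  by move=> x Ax; have [|] := pselect (A° x); [left|right].
apply: setU_meager => //; apply: nowhere_dense_meager.
apply/nowhere_denseP => O oO O0.
have [OA|OA] := eqVneq (O `&` ~` A) set0.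
  have sOA : O `<=` A°.
    by rewrite -open_subsetE//; exact/subsets_disjoint.
  exists O => //; split => //; rewrite -subset0 => x [Ox [_]]; apply.
  exact: sOA.
exists (O `&` ~` A); first by apply: openI => //; exact: closed_openC.
split; [exact/set0P|exact: subIsetl|].
by rewrite -subset0 => x [[_ nAx] [Ax]].
Qed.

End Category.

(** * Plays of the Banach-Mazur game *)

(** Maximality enters only here: a set [V] missed by the whole disjoint family
contains no non-empty member of [D], which could otherwise be added. *)
Lemma maximal_disjoint_dense (T : topologicalType) (S : Type) (U : S -> set T)
    (D E : set S) (V : set T) :
  maximal_disjoint_subcollection U E D ->
  (exists s, [/\ D s, U s !=set0 & U s `<=` V]) ->
  exists2 s, E s & V `&` U s !=set0.
Proof.
move=> [ED tE maxE] [s [Ds [x Usx] UV]].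
have [//|h] := pselect (exists2 s, E s & V `&` U s !=set0).
have nEs : ~ E s.
  by move=> Es; apply: h; exists s => //; exists x; split=> //; exact: UV.
exfalso; apply: (maxE (E `|` [set s])).
- rewrite properEneq; split; last exact: subsetUl.
  by apply/eqP => EE; apply: nEs; rewrite EE; right.
- by move=> t [/ED//|->].
- move=> i j [Ei|->] [Ej|->] //; first exact: tE.
  + move=> [z [Uiz Usz]]; exfalso; apply: h; exists i => //; exists z.
    by split=> //; exact: UV.
  + move=> [z [Usz Ujz]]; exfalso; apply: h; exists j => //; exists z.
    by split=> //; exact: UV.
Qed.

Section BanachMazur.
Context {T : topologicalType} {S : Type}.
Variables (U : S -> set T) (step : S -> S -> Prop) (s0 : S).
Hypothesis oU0 : open (U s0).
Hypothesis stepP : forall s V, open V -> V !=set0 -> V `<=` U s ->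
  exists s', [/\ step s s', open (U s'), U s' !=set0 & U s' `<=` V].

Let succ s := [set s' | [/\ step s s', open (U s') & U s' `<=` U s]].
Let branch s := sval (ex_maximal_disjoint_subcollection U (succ s)).

Let branchP s : maximal_disjoint_subcollection U (branch s) (succ s).
Proof. exact: (svalP (ex_maximal_disjoint_subcollection U (succ s))). Qed.

Let branch_dense s V : open V -> V !=set0 -> V `<=` U s ->
  exists2 s', branch s s' & V `&` U s' !=set0.
Proof.
move=> oV V0 VU; apply: maximal_disjoint_dense (branchP s) _.
have [s' [ss' oU' U'0 U'V]] := stepP oV V0 VU.
by exists s'; split => //; split => //; exact: subset_trans VU.
Qed.

Let level := fix level n : set S := if n is m.+1 then
  [set s' | exists2 s, level m s & branch s s'] else [set s0].

Let level_open n s : level n s -> open (U s).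
Proof.
case: n => [->//|n [t _ ts]].
by have [/(_ _ ts) [_ ? _] _ _] := branchP t.
Qed.

Let level_disjoint n : trivIset (level n) U.
Proof.
elim: n => [|n IHn] /=; first by move=> i j -> ->.
move=> i j [s Ls si] [t Lt tj] [x [Uix Ujx]].
have [sub_s tr_s _] := branchP s; have [sub_t _ _] := branchP t.
have [_ _ Uis] := sub_s _ si; have [_ _ Ujt] := sub_t _ tj.
have st : s = t.
  by apply: IHn => //; exists x; split; [exact: Uis|exact: Ujt].
by move: tj; rewrite -st => sj; apply: tr_s => //; exists x.
Qed.

(* The points that a branch of the tree reaches at level [n] but cannot follow
   to level [n.+1]. *)
Let lost n := [set p | exists s,
  [/\ level n s, U s p & ~ exists2 s', branch s s' & U s' p]].

Let lost_nowhere_dense n : nowhere_dense (lost n).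
Proof.
apply/nowhere_denseP => O oO O0.
have [[s Ls OU]|h] := pselect (exists2 s, level n s & O `&` U s !=set0).
  have oOU : open (O `&` U s) by apply: openI => //; exact: level_open Ls.
  have [s' ss' OUs'] := branch_dense oOU OU (@subIsetr _ _ _).
  have [_ oU' _] : succ s s' by have [+ _ _] := branchP s; apply.
  exists (O `&` U s `&` U s'); first exact: openI.
  split=> //; first by move=> x [[]].
  rewrite -subset0 => p [[[_ Up] U'p] [t [Lt Utp]]]; apply.
  have <- : s = t by apply: (level_disjoint Ls Lt); exists p.
  by exists s'.
exists O => //; split => //; rewrite -subset0 => p [Op [s [Ls Up _]]].
by apply: h; exists s => //; exists p.
Qed.

(** Oxtoby's argument. From each position keep only a maximal family of moves
to pairwise disjoint regions; these regions are dense in the current one. The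
regions of a given level being disjoint, the points lost at that level are
nowhere dense, and a point that is never lost determines a play. *)
Lemma meager_no_play : meager [set p | U s0 p /\
  ~ exists sigma : nat -> S, [/\ sigma 0 = s0,
      forall n, step (sigma n) (sigma n.+1) & forall n, U (sigma n) p]].
Proof.
apply: (@sub_meager _ _ (\bigcup_n lost n)); last first.
  by apply: bigcup_meager => n; exact/nowhere_dense_meager/lost_nowhere_dense.
move=> p [U0p]; apply: contra_notP => nlost.
have /choice[next nextP] : forall s, exists s',
    (exists2 t, branch s t & U t p) -> branch s s' /\ U s' p.
  move=> s; have [[t st tp]|h] := pselect (exists2 t, branch s t & U t p).
    by exists t.
  by exists s => /h.
pose sigma n := iter n next s0.
have sP n : level n (sigma n) /\ U (sigma n) p.
  elim: n => [//|n [Ls Us]]; have [] := nextP (sigma n).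
    apply: contrapT => h; apply: nlost; exists n => //; exists (sigma n).
    by split.
  by move=> bs Us'; split => //; exists (sigma n).
exists sigma; split => // n; last by have [] := sP n.
have [_ [s sL sb]] : True /\ level n.+1 (sigma n.+1) by have [] := sP n.+1.
have [Ls Us] := sP n.
have [] := nextP (sigma n); last first.
  by have [sub _ _] := branchP (sigma n) => /sub [].
apply: contrapT => h; apply: nlost; exists n => //; exists (sigma n).
by split.
Qed.

End BanachMazur.

(** * Compactness by covers and by filters *)

Section Compactness.
Context {Y : topologicalType}.

Lemma compact_space_compact : compact_space Y -> compact [set: Y].
Proof.
move=> cY F PF _; apply: contrapT => noc.
have /choice[W WP] : forall y : Y, exists O : set Y,
    [/\ open O, O y & F (~` O)].
  move=> y; apply: contrapT => nO; apply: noc; exists y; split => // A B FA.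
  rewrite nbhsE => -[V [oV Vy] VB]; apply: contrapT => AB; apply: nO.
  exists V; split => //; apply: filterS FA => x Ax Vx; apply: AB; exists x.
  by split => //; exact: VB.
have [||D _ Dcov] := cY Y setT W; first by move=> y _; have [] := WP y.
  by move=> y _; exists y => //; have [] := WP y.
have : F (\bigcap_(y in [set` D]) ~` W y).
  by apply: filter_bigI => y _; have [] := WP y.
move=> /filter_ex[x xO]; have [|y Dy Oyx] := Dcov x; first by [].
exact: xO Oyx.
Qed.

Lemma compact_compact_space : compact [set: Y] -> compact_space Y.
Proof.
move=> cY I D O oO DO; apply: contrapT => nfin.
pose F := filter_from [set D' : {fset I} | {subset D' <= D}]
  (fun D' => ~` cover [set` D'] O).
have FF : ProperFilter F.
  apply: filter_from_proper.
    apply: filter_from_filter; first by exists fset0 => i; rewrite inE.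
    move=> D1 D2 D1D D2D; exists (D1 `|` D2)%fset.
      by move=> i; rewrite inE => /orP[/D1D|/D2D].
    move=> x /= nx; split=> -[i Di Oi]; apply: nx; exists i => //=;
      by rewrite inE Di ?orbT.
  move=> D' D'D; apply: contrapT => h; apply: nfin; exists D' => // x _.
  by apply: contrapT => nx; apply: h; exists x.
have [p [_ Fp]] := cY F FF filterT.
have [i Di Oip] := DO p Logic.I.
have [] := Fp (~` O i) (O i); last by move=> x [].
  exists [fset i]%fset; first by move=> j; rewrite inE => /eqP ->; rewrite inE.
  by move=> x /= nx Oix; apply: nx; exists i => //=; rewrite inE.
by apply: open_nbhs_nbhs; split => //; exact: oO.
Qed.

End Compactness.

Lemma compact_set_type (T : topologicalType) (K : set T) :
  compact K -> compact [set: set_type K].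
Proof.
move=> cK F FF _.
have FK : (set_val @ F) K.
  by apply: (@filterS _ F _ setT) => [x _|]; [exact: set_valP|exact: filterT].
have [p [Kp Fp]] := cK (set_val @ F) _ FK.
exists (exist _ p (mem_set Kp)); split => // A B FA.
move=> [_ [[V oV <-] /= Vp] VB].
have [q [[x Ax <-] Vx]] : set_val @` A `&` V !=set0.
  apply: Fp.
- by rewrite /fmap /=; apply: filterS FA => x Ax; exists x.
- exact: open_nbhs_nbhs.
- by exists x; split => //; exact: VB.
Qed.

(** * Boxes in products of pseudo-metric spaces *)

Section ProductBoxes.
Context {R : realType} {I : choiceType} (M : I -> pseudoMetricType R).
Local Notation Q := (prod_topology (fun i => M i : topologicalType)).

Lemma nbhs_prod_ball (p : Q) (V : set Q) : nbhs p V ->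
  exists (J : {fset I}) (r : R), 0 < r /\
    forall q : Q, (forall i, i \in J -> ball (p i) r (q i)) -> V q.
Proof.
pose G : set_system Q :=
  [set V : set Q | exists (J : {fset I}) (r : R), 0 < r /\
    forall q : Q, (forall i, i \in J -> ball (p i) r (q i)) -> V q].
suff cvGp : G --> p by exact: cvGp.
have GF : Filter G.
  split.
  - by exists fset0, 1.
  - move=> A B [J [r [r0 JA]]] [K [s [s0 KB]]].
    exists (J `|` K)%fset, (Num.min r s); rewrite lt_min r0 s0; split => // q h.
    split; [apply: JA|apply: KB] => i ij.
      by apply: le_ball (h i _); rewrite ?ge_min ?lexx// inE ij.
    by apply: le_ball (h i _); rewrite ?ge_min ?lexx ?orbT// inE ij orbT.
  - by move=> A B AB [J [r [r0 JA]]]; exists J, r; split => // q /JA/AB.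
apply/cvg_sup => i V' [_ [[U oU <-] /= Up] UV'].
have /nbhs_ballP[r r0 rU] : nbhs (p i) U by exact: open_nbhs_nbhs.
exists [fset i]%fset, r; split => // q h; apply: UV'; apply: rU; apply: h.
by rewrite inE.
Qed.

Lemma prod_ball_nbhs (p : Q) (J : {fset I}) (r : R) : 0 < r ->
  nbhs p [set q : Q | forall i, i \in J -> ball (p i) r (q i)].
Proof.
move=> r0; apply: filterS (_ : nbhs p (\bigcap_(i in [set` J])
    [set q : Q | ball (p i) r (q i)])); first by move=> q h i /h.
apply: filter_bigI => i _.
by apply: (@proj_continuous _ _ i p); exact: nbhsx_ballx.
Qed.

End ProductBoxes.

(** * Oscillation of separately continuous functions *)

Section Oscillation.
Context {R : realType} {T Y : topologicalType} (f : T * Y -> R).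
Hypothesis cY : compact [set: Y].
Hypothesis scf : separately_continuous f.

Let f1_cvg x y : f (x', y) @[x' --> x] --> f (x, y).
Proof. exact: (scf.1 y x). Qed.

Let f2_cvg x y : f (x, y') @[y' --> y] --> f (x, y).
Proof. exact: (scf.2 x y). Qed.

(** [f (_, y)] oscillates by at most [eps] on one neighbourhood of the point,
the same for all [y]; two variable points are compared so that the set is
open. *)
Definition small_osc (eps : R) : set T := [set x | exists V : set T,
  [/\ open V, V x & forall x1 x2 y, V x1 -> V x2 ->
    `|f (x1, y) - f (x2, y)| <= eps]].

Lemma small_osc_open eps : open (small_osc eps).
Proof.
rewrite openE => x [V [oV Vx VP]].
apply: filterS (open_nbhs_nbhs (conj oV Vx)) => t Vt.
by exists V.
Qed.

Lemma small_osc_continuous x y :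
  (forall k, small_osc k.+1%:R^-1 x) -> {for (x, y), continuous f}.
Proof.
move=> sx; apply/cvgrPdist_lt => eps eps0.
have eps20 : 0 < eps / 2 by rewrite divr_gt0.
have [k _ /(_ k (leqnn k)) /= keps] := near_infty_natSinv_lt (PosNum eps20).
have [V [oV Vx Vosc]] := sx k.
have /cvgrPdist_lt/(_ (eps / 2)) fy := @f2_cvg x y.
exists (V, [set y' | `|f (x, y) - f (x, y')| < eps / 2]) => /=.
  split; first exact: open_nbhs_nbhs.
  exact: fy.
move=> [x' y'] /= [Vx' fy'].
rewrite (splitr eps) (le_lt_trans (ler_distD (f (x, y')) _ _))// ltrD//.
exact: le_lt_trans (Vosc _ _ y' Vx Vx') keps.
Qed.

(** If no such pair exists, then on [V] the value [f (x, y)] is controlled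
within [delta] by the values [f (c, y)] at the points [c] of [pts]. Around each
[y] three such comparisons bound [f (x, y') - f (x1, y')] by [3 * delta], for [x]
near [x1] and [y'] near [y]; compactness of [Y] makes the neighbourhood of [x1]
independent of [y], so that [x1] has oscillation at most [6 * delta]. *)
Lemma separating_pair (delta eta : R) (pts : seq T) (V : set T) (x1 : T) :
  0 < delta -> 0 < eta -> open V -> V x1 -> ~ small_osc (6 * delta) x1 ->
  exists x y z, [/\ V x, delta < `|f (x, y) - f (x, z)| &
    forall c, c \in pts -> `|f (c, y) - f (c, z)| < eta].
Proof.
move=> delta0 eta0 oV Vx1 nosc; apply: contrapT => nsep.
have close x y z : V x ->
    (forall c, c \in pts -> `|f (c, y) - f (c, z)| < eta) ->
    `|f (x, y) - f (x, z)| <= delta.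
  by move=> Vx h; rewrite leNgt; apply/negP => d; apply: nsep; exists x, y, z.
have near_close y : \forall y' \near y,
    forall c, c \in pts -> `|f (c, y) - f (c, y')| < eta.
  apply: filterS (_ : nbhs y (\bigcap_(c in [set` [fset c in pts]%fset])
      [set y' | `|f (c, y) - f (c, y')| < eta])) => [y' h c cpts|].
    by apply: h; rewrite /= !inE.
  by apply: filter_bigI => c _; have /cvgrPdist_lt := @f2_cvg c y; exact.
pose P x y := V x /\ `|f (x1, y) - f (x, y)| <= 3 * delta.
have Pnear y : [set: Y] y -> \forall y' \near y & x \near nbhs x1, P x y'.
  move=> _; have /cvgrPdist_lt/(_ _ delta0) fx := @f1_cvg x1 y.
  exists ([set y' | forall c, c \in pts -> `|f (c, y) - f (c, y')| < eta],
    V `&` [set x | `|f (x1, y) - f (x, y)| < delta]) => /=.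
    split; first exact: near_close.
    by apply: filterI => //; exact: open_nbhs_nbhs.
  move=> [y' x] /= [yy' [Vx xx1]]; split => //.
  have d1 := close _ _ _ Vx1 yy'; have d2 := close _ _ _ Vx yy'.
  by move: d1 d2 xx1; rewrite !ler_norml !ltr_norml; lra.
have := (compact_near_coveringP [set: Y]).1 cY _ _ _ _ Pnear.
move=> /(_ (nbhs_filter x1)); rewrite /prop_near1 /= nbhsE => -[W [oW Wx1] WP].
apply: nosc; exists (V `&` W); split => //; first exact: openI.
move=> x2 x3 y [_ /WP/(_ y Logic.I)[_ d2]] [_ /WP/(_ y Logic.I)[_ d3]].
by move: d2 d3; rewrite !ler_norml; lra.
Qed.

End Oscillation.

(** * The oscillation game in a product of pseudo-metric spaces *)

Section OscillationGame.
Context {R : realType} {I : choiceType} (M : I -> pseudoMetricType R).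
Local Notation Q := (prod_topology (fun i => M i : topologicalType)).
Context {T Y : topologicalType} (e : T -> Q) (f : T * Y -> R).
Hypothesis e_inj : injective e.
Hypothesis e_open : forall V : set T, open V -> open (e @` V).
Hypothesis e_cts : continuous e.
Hypothesis cY : compact [set: Y].
Hypothesis scf : separately_continuous f.

Record position := Position {
  region : set T; coords : {fset I}; centres : seq T }.

(** The move picks the pair [(y, z)] and a box of centre [e a], radius [r], on
the coordinates [coords s']. The second conjunct of the second group also says
that the box lies in the range of [e], so that limit points built in the product
come from [T]; the first only asks the region to lie in the box, because balls
need not be open. *)
Definition move_by (b : Q) (delta : R) (a : T) (r : R) (y z : Y)
    (s s' : position) : Prop :=
  [/\ centres s' = a :: centres s,
      {subset coords s <= coords s'},
      forall i, i \notin coords s' -> e a i = b i &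
      r <= (size (centres s)).+1%:R^-1] /\
  [/\ forall p i, region s' p -> i \in coords s' -> ball (e a i) r (e p i),
      forall q : Q, (forall i, i \in coords s' -> ball (e a i) r (q i)) ->
        exists2 t, e t = q & delta < `|f (t, y) - f (t, z)| &
      forall c, c \in centres s ->
        `|f (c, y) - f (c, z)| < (size (centres s)).+1%:R^-1].

Definition move b delta s s' := exists a r y z, move_by b delta a r y z s s'.

Lemma move_exists (b : Q) (delta : R) (D V : set T) (s : position) :
  0 < delta -> (forall x, D x -> ~ small_osc f (6 * delta) x) ->
  open V -> V !=set0 -> V `<=` D ->
  exists s', [/\ move b delta s s', open (region s'), region s' !=set0 &
    region s' `<=` V].
Proof.
move=> delta0 nD oV [x1 Vx1] VD.
have eta0 : 0 < (size (centres s)).+1%:R^-1 :> R by rewrite invr_gt0.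
have [x2 [y [z [Vx2 yz2 yz]]]] := separating_pair cY scf (centres s)
  delta0 eta0 oV Vx1 (nD _ (VD _ Vx1)).
pose V' := V `&` [set x | delta < `|f (x, y) - f (x, z)|].
have oV' : open V'.
  apply: openI => //.
  have cts : continuous (fun x => `|f (x, y) - f (x, z)|).
    by move=> x; apply: cvg_norm; apply: cvgB; [exact: scf.1|exact: scf.1].
  exact: (@open_comp _ _ _ [set u | delta < u] (fun x _ => cts x) (@open_gt _ _)).
have [J [r [r0 JV]]] : exists (J : {fset I}) (r : R), 0 < r /\
    forall q : Q, (forall i, i \in J -> ball (e x2 i) r (q i)) -> (e @` V') q.
  apply: nbhs_prod_ball; apply: open_nbhs_nbhs; split; first exact: e_open.
  by exists x2.
pose J' := (J `|` coords s)%fset.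
pose q1 : Q := fun i => if i \in J' then e x2 i else b i.
have [a V'a ea] : (e @` V') q1.
  by apply: JV => i iJ; rewrite /q1 inE iJ /=; exact: ballxx.
pose r' := Num.min r (size (centres s)).+1%:R^-1.
have r'0 : 0 < r' by rewrite lt_min r0.
pose W := V' `&` (e @^-1` [set q | forall i, i \in J' -> ball (e a i) r' (q i)])°.
have Wa : W a.
  by split => //; apply: e_cts; exact: prod_ball_nbhs.
exists (Position W J' (a :: centres s)); split.
- exists a, r', y, z; split; split => //=.
  + by move=> i iJ; rewrite inE iJ orbT.
  + by move=> i /negbTE iJ; rewrite ea /q1 iJ.
  + by rewrite ge_min lexx orbT.
  + by move=> p i [_ /interior_subset]; exact.
  + move=> q qJ; have [i iJ|t V't <-] := JV q; last by exists t => //; case: V't.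
    have iJ' : i \in J' by rewrite inE iJ.
    have := qJ i iJ'; rewrite ea /q1 iJ'; apply: le_ball.
    by rewrite ge_min lexx.
- by apply: openI => //; exact: open_interior.
- by exists a.
- by move=> x [[]].
Qed.

(** The survivor [p] is replaced by the point [q] that agrees with the base
point [b] off the coordinates used in the play: only [q] is the limit of the
centres. *)
Lemma no_infinite_play (b : Q) (delta : R) (sigma : nat -> position) (p : T) :
  0 < delta -> centres (sigma 0) = [::] ->
  (forall n, move b delta (sigma n) (sigma n.+1)) ->
  (forall n, region (sigma n) p) -> False.
Proof.
move=> delta0 c0 sigmaM sigmap.
have /choice[w wP] : forall n, exists w : (T * R) * (Y * Y),
    move_by b delta w.1.1 w.1.2 w.2.1 w.2.2 (sigma n) (sigma n.+1).
  by move=> n; have [a [r [y [z ?]]]] := sigmaM n; exists ((a, r), (y, z)).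
pose a n := (w n).1.1; pose r n := (w n).1.2.
have sizeE n : size (centres (sigma n)) = n.
  elim: n => [|n IHn]; first by rewrite c0.
  by have [[-> _ _ _] _] := wP n; rewrite /= IHn.
have r_le n : r n <= n.+1%:R^-1 by have [[_ _ _]] := wP n; rewrite sizeE.
have coords_le m n : (m <= n)%N ->
    {subset coords (sigma m) <= coords (sigma n)}.
  elim: n => [|n IHn]; first by rewrite leqn0 => /eqP ->.
  rewrite leq_eqVlt => /predU1P[->//|/IHn mn] i /mn.
  by have [[_ + _ _] _] := wP n; apply.
have a_centre m n : (m < n)%N -> a m \in centres (sigma n).
  elim: n => // n IHn; have [[cE _ _ _] _] := wP n.
  by rewrite cE ltnS leq_eqVlt inE => /predU1P[->|/IHn ->]; rewrite ?eqxx ?orbT.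
pose q : Q := fun i =>
  if `[< exists n, i \in coords (sigma n) >] then e p i else b i.
have q_ball n i : i \in coords (sigma n.+1) -> ball (e (a n) i) (r n) (q i).
  move=> iJ; rewrite /q asboolT; last by exists n.+1.
  by have [_ [+ _ _]] := wP n; apply.
have [t et] : exists t, e t = q.
  by have [_ [_ /(_ q (q_ball 0%N))[t ? _] _]] := wP 0%N; exists t.
have tP n : delta < `|f (t, (w n).2.1) - f (t, (w n).2.2)|.
  have [_ [_ /(_ q (q_ball n))[t' et' ?] _]] := wP n.
  by have -> : t = t' by apply: e_inj; rewrite et.
have a_cvg : a @ \oo --> t.
  move=> V; rewrite nbhsE => -[V' [oV' V't] V'V].
  have [J [r0 [r00 JV]]] : exists (J : {fset I}) (r : R), 0 < r /\
      forall q' : Q, (forall i, i \in J -> ball (q i) r (q' i)) -> (e @` V') q'.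
    apply: nbhs_prod_ball; apply: open_nbhs_nbhs; split; first exact: e_open.
    by exists t.
  apply: (@filterS _ _ _ (\bigcap_(i in [set` J])
      [set n | ball (q i) r0 (e (a n) i)])) => [n h|].
    have [i /h //|x V'x /e_inj xa] := JV (e (a n)).
    by apply: V'V; rewrite -xa.
  apply: filter_bigI => i _.
  have [[m im]|nJ] := pselect (exists n, i \in coords (sigma n)).
    have := near_infty_natSinv_lt (PosNum r00).
    apply: filter_app; exists m => // n /= mn rn.
    apply: ball_sym; apply: le_ball (q_ball n i _).
      exact: (le_trans (r_le n) (ltW rn)).
    by apply: (coords_le m) => //; exact: leqW.
  exists 0%N => // n _ /=; have [[_ _ aE _] _] := wP n.
  have -> : e (a n) i = b i.
    by apply: aE; apply/negP => iJ; apply: nJ; exists n.+1.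
  by rewrite /q asboolF//; exact: ballxx.
have cts2 x : continuous (fun yz : Y * Y => `|f (x, yz.1) - f (x, yz.2)|).
  move=> yz; apply: cvg_norm; apply: cvgB.
    by apply: (@cvg_comp _ _ _ fst (fun y => f (x, y)));
      [exact: cvg_fst|exact: scf.2].
  by apply: (@cvg_comp _ _ _ snd (fun y => f (x, y)));
      [exact: cvg_snd|exact: scf.2].
have [[y z] [_ yz]] : [set: Y * Y] `&` cluster ((fun n => (w n).2) @ \oo) !=set0.
  rewrite -setXTT; apply: (compact_setX cY cY).
  by rewrite setXTT; exact: filterT.
have fa m : f (a m, y) = f (a m, z).
  apply/eqP; rewrite -subr_eq0 -normr_le0 leNgt; apply/negP => d0.
  have d20 : 0 < `|f (a m, y) - f (a m, z)| / 2 by rewrite divr_gt0.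
  have /= [] := yz [set yz | `|f (a m, yz.1) - f (a m, yz.2)| <
                             `|f (a m, y) - f (a m, z)| / 2]
                   [set yz | `|f (a m, y) - f (a m, z)| / 2 <
                             `|f (a m, yz.1) - f (a m, yz.2)|].
  - have := near_infty_natSinv_lt (PosNum d20).
    apply: filter_app; exists m.+1 => // n /= mn.
    apply: lt_trans; have [_ [_ _]] := wP n; rewrite sizeE; apply.
    exact: a_centre.
  - apply: open_nbhs_nbhs; split.
      exact: (@open_comp _ _ _ [set u | _ < u] (fun x _ => cts2 _ x) (@open_gt _ _)).
    by rewrite /= ltr_pdivrMr// ltr_pMr// ltr1n.
  - by move=> [y' z'] [/= h1 h2]; have := lt_trans h1 h2; rewrite ltxx.
have ft : f (t, y) = f (t, z).
  have cvgf u : f (a n, u) @[n --> \oo] --> f (t, u).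
    by apply: (@cvg_comp _ _ _ a (fun x => f (x, u)));
      [exact: a_cvg|exact: scf.1].
  have cvgy := cvgf y; have cvgz := cvgf z.
  rewrite -(_ : (fun n => f (a n, y)) = fun n => f (a n, z)) in cvgz.
    exact: cvg_unique cvgy cvgz.
  exact/funext.
have /= [] := yz [set yz | delta < `|f (t, yz.1) - f (t, yz.2)|]
                 [set yz | `|f (t, yz.1) - f (t, yz.2)| < delta].
- by exists 0%N => // n _ /=; exact: tP.
- apply: open_nbhs_nbhs; split; last by rewrite /= ft subrr normr0.
  exact: (@open_comp _ _ _ [set u | u < _] (fun x _ => cts2 _ x) (@open_lt _ _)).
- by move=> [y' z'] [/= h1 h2]; have := lt_trans h1 h2; rewrite ltxx.
Qed.

(** The game is played inside the interior of the set of large oscillation,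
where a move is always available. *)
Lemma not_small_osc_meager (eps : R) : 0 < eps -> meager (~` small_osc f eps).
Proof.
move=> eps0; pose delta := eps / 6.
have delta0 : 0 < delta by rewrite divr_gt0.
have epsE : 6 * delta = eps by rewrite /delta mulrC divfK.
apply: closed_meager_interior; first exact/open_closedC/small_osc_open.
set D := (~` small_osc f eps)°.
have [D0|/set0P[x0 Dx0]] := eqVneq D set0.
  rewrite D0; apply: nowhere_dense_meager.
  by rewrite /nowhere_dense closure0 interior0.
pose b := e x0.
have nD x : D x -> ~ small_osc f (6 * delta) x.
  by rewrite epsE; exact: interior_subset.
(* A position whose region is not within [D] may admit no move. *)
pose S := {s : position | region s `<=` D}.
pose s0 : S := exist _ (Position D fset0 [::]) (@subset_refl _ D).
apply: (@sub_meager _ _ [set p | D p /\ ~ exists sigma : nat -> S,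
    [/\ sigma 0%N = s0,
        forall n, move b delta (sval (sigma n)) (sval (sigma n.+1)) &
        forall n, region (sval (sigma n)) p]]).
  move=> p Dp; split => // -[sigma [sigma0 sigmaM sigmap]].
  apply: (@no_infinite_play b delta (fun n => sval (sigma n)) p) => //.
  by rewrite sigma0.
apply: (@meager_no_play _ _ (fun s : S => region (sval s))
  (fun s s' => move b delta (sval s) (sval s')) s0).
  exact: open_interior.
move=> [s sD] V oV V0 /= Vs.
have VD := subset_trans Vs sD.
have [s' [ss' os' s'0 s'V]] := move_exists b s delta0 nD oV V0 VD.
by exists (exist _ s' (subset_trans s'V VD)).
Qed.

End OscillationGame.

(** * A function discontinuous at the origin *)

Section SeparatelyContinuousRatio.
Context {R : realType}.
Implicit Types s t : R.

Definition ratio s t : R := s * t / (s ^+ 2 + t ^+ 2).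

Lemma ratioC s t : ratio s t = ratio t s.
Proof. by rewrite /ratio [s * t]mulrC addrC. Qed.

Lemma ratio0 s : ratio s 0 = 0.
Proof. by rewrite /ratio mulr0 mul0r. Qed.

Lemma ratio_diag t : t != 0 -> ratio t t = 1 / 2.
Proof.
move=> t0; rewrite /ratio; field.
by rewrite -mulr2n mulrn_eq0 /= expf_eq0.
Qed.

Lemma ratio_le1 s t : `|ratio s t| <= 1.
Proof.
have [->|t0] := eqVneq t 0; first by rewrite ratio0 normr0.
have st0 : 0 < s ^+ 2 + t ^+ 2.
  by rewrite ltr_wpDl ?sqr_ge0// lt_neqAle eq_sym expf_eq0 /= t0 sqr_ge0.
rewrite /ratio normrM normfV (gtr0_norm st0) ler_pdivrMr// mul1r ler_norml.
have := sqr_ge0 (s + t); have := sqr_ge0 (s - t).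
have := sqr_ge0 s; have := sqr_ge0 t.
by rewrite sqrrB sqrrD; lra.
Qed.

Lemma ratio_continuous s : continuous (ratio s).
Proof.
move=> t; have [->|s0] := eqVneq s 0.
  rewrite [X in continuous_at _ X](_ : _ = cst 0); first exact: cvg_cst.
  by apply/funext => u; rewrite ratioC ratio0.
apply: cvgM; first by apply: cvgM; [exact: cvg_cst|exact: cvg_id].
apply: cvgV.
  by rewrite gt_eqF// ltr_pwDl ?sqr_ge0// lt_neqAle eq_sym expf_eq0 /= s0 sqr_ge0.
by apply: cvgD; [exact: cvg_cst|exact: exprn_continuous].
Qed.

Lemma scaled_ratio_cvg (S : topologicalType) (c t : R) (g : S -> R) (y : S) :
  g y' @[y' --> y] --> g y ->
  c * ratio (g y') t @[y' --> y] --> c * ratio (g y) t.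
Proof.
move=> cg; have cr : ratio s t @[s --> g y] --> ratio (g y) t.
  rewrite (_ : ratio^~ t = ratio t); last by apply/funext => s; exact: ratioC.
  by rewrite ratioC; exact: ratio_continuous.
apply: (cvgM (cvg_cst c)).
exact: (@cvg_comp _ _ _ g (ratio^~ t) _ _ _ cg cr).
Qed.

End SeparatelyContinuousRatio.

(** * The compact hedgehog *)

Section Hedgehog.
Context {R : realType} {J : choiceType}.
Local Notation cube := (prod_topology (fun _ : J => R : topologicalType)).

(** Points of the cube with at most one non-zero coordinate: segments [[0, 1]]
glued at 0, where a neighbourhood of 0 contains all but finitely
many of them. *)
Definition hedgehog : set cube := [set y |
  (forall i, 0 <= y i <= 1) /\ forall i k, i != k -> y i * y k = 0].

Lemma hedgehog_compact : compact hedgehog.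
Proof.
have cC : compact [set y : cube | forall i, `[0, 1]%classic (y i)].
  by apply: (@tychonoff J (fun=> R : topologicalType) (fun=> `[0, 1]%classic))
    => i; exact: segment_compact.
apply: (subclosed_compact _ cC); last first.
  by move=> y [y01 _] i; rewrite /= in_itv /= y01.
have -> : hedgehog = [set y : cube | forall i, `[0, 1]%classic (y i)] `&`
    \bigcap_(ik in [set ik : J * J | ik.1 != ik.2])
      [set y : cube | y ik.1 * y ik.2 = 0].
  apply/seteqP; split=> y.
    move=> [y01 yy]; split; first by move=> i; rewrite /= in_itv /= y01.
    by move=> [i k] /= ik; exact: yy.
  move=> [y01 yy]; split => [i|i k ik]; last exact: (yy (i, k)).
  by have := y01 i; rewrite /= in_itv /=.
have cts i : continuous (fun y : cube => y i).
  exact: (@proj_continuous J (fun=> R : topologicalType) i).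
apply: closedI.
  have -> : [set y : cube | forall i, `[0, 1]%classic (y i)] =
      \bigcap_i ((fun y : cube => y i) @^-1` `[0, 1]%classic).
    by apply/seteqP; split=> y h i; [move=> _; exact: h|exact: h].
  apply: closed_bigI => i _; apply: closed_comp; first by move=> y _; exact: cts.
  exact: itv_closed.
apply: closed_bigI => -[i k] _ /=.
have cts2 : continuous (fun y : cube => y i * y k).
  by move=> y; exact: (cvgM (cts i y) (cts k y)).
exact: (@closed_comp _ _ (fun y : cube => y i * y k) [set t : R | t = 0]
  (fun y _ => cts2 y) (@closed_eq _ _)).
Qed.

Definition spike_fun (i : J) (t : R) : cube := fun k => if k == i then t else 0.

Lemma spike_hedgehog i t : 0 <= t <= 1 -> hedgehog (spike_fun i t).
Proof.
move=> t01; split => [k|k l kl]; rewrite /spike_fun.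
  by case: eqP => // _; rewrite lexx ler01.
case: eqP => [ki|]; rewrite ?mul0r//; case: eqP => [li|]; rewrite ?mulr0//.
by move: kl; rewrite ki li eqxx.
Qed.

End Hedgehog.

(** * Separately continuous functions on a hedgehog *)

Section HedgehogFunction.
Context {R : realType} {T : topologicalType} {J : choiceType}.
Variable u : nat -> J -> T -> R.
Hypothesis u_cts : forall n j, continuous (u n j).
Hypothesis u01 : forall n j x, 0 <= u n j x <= 1.
Hypothesis u_disjoint : forall n j k x, u n j x != 0 -> u n k x != 0 -> j = k.

Local Notation idx := (nat * J)%type.
Local Notation cube := (prod_topology (fun _ : idx => R : topologicalType)).
Local Notation H := (@hedgehog R idx).

(** The sum over all indices of [ratio (y i) (u i x) / (i.1 + 1)], which has at
most one non-zero term. *)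
Definition hedgehog_fun (xy : T * set_type H) : R :=
  if pselect (exists i, set_val xy.2 i != 0) is left h then
    let i := sval (cid h) in
    i.1.+1%:R^-1 * ratio (set_val xy.2 i) (u i.1 i.2 xy.1)
  else 0.

Lemma hedgehog_funE (x : T) (y : set_type H) (i : idx) :
  (forall k, k != i -> set_val y k = 0) ->
  hedgehog_fun (x, y) = i.1.+1%:R^-1 * ratio (set_val y i) (u i.1 i.2 x).
Proof.
move=> yi; rewrite /hedgehog_fun /=; case: pselect => [h|h].
  case: cid => /= k; have [->//|ki] := eqVneq k i.
  by rewrite yi// eqxx.
have -> : set_val y i = 0 by apply/eqP/negPn/negP => yi0; apply: h; exists i.
by rewrite ratioC ratio0 mulr0.
Qed.

Lemma hedgehog_supp (y : set_type H) (i : idx) :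
  set_val y i != 0 -> forall k, k != i -> set_val y k = 0.
Proof.
move=> yi k ki; have [_ /(_ k i ki) /eqP] := set_valP y.
by rewrite mulf_eq0 (negbTE yi) orbF => /eqP.
Qed.

Let coord_cts (i : idx) : continuous (fun y : set_type H => set_val y i).
Proof.
move=> y; apply: (@continuous_comp (set_type H) cube R set_val (fun y : cube => y i)).
  exact: initial_continuous.
exact: (@proj_continuous idx (fun=> R : topologicalType) i).
Qed.

(** Only one function [u n j] matters for a given [y]. *)
Lemma hedgehog_fun_cts1 (y : set_type H) :
  continuous (fun x => hedgehog_fun (x, y)).
Proof.
have [[i yi]|y0] := pselect (exists i, set_val y i != 0).
  have -> : (fun x => hedgehog_fun (x, y)) =
      (fun x => i.1.+1%:R^-1 * ratio (u i.1 i.2 x) (set_val y i)).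
    by apply/funext => x; rewrite (hedgehog_funE _ (hedgehog_supp yi)) ratioC.
  by move=> x; exact: scaled_ratio_cvg (@u_cts i.1 i.2 x).
have -> : (fun x => hedgehog_fun (x, y)) = cst 0.
  by apply/funext => x; rewrite /hedgehog_fun /=; case: pselect.
by move=> x; exact: cvg_cst.
Qed.

(** The delicate point is [y = 0]. The factor [1 / (n + 1)] takes care of large
[n]; for each of the finitely many other [n], disjointness of supports leaves at
most one [j] with [u n j x != 0], hence one coordinate to make small. *)
Lemma hedgehog_fun_cts2 (x : T) : continuous (fun y => hedgehog_fun (x, y)).
Proof.
move=> y; have FFy : Filter (nbhs y) by exact: nbhs_filter.
have [[i yi]|y0] := pselect (exists i, set_val y i != 0).
  have cts : (fun y' : set_type H => i.1.+1%:R^-1 *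
      ratio (set_val y' i) (u i.1 i.2 x)) y' @[y' --> y]
      --> hedgehog_fun (x, y).
    rewrite (hedgehog_funE x (hedgehog_supp yi)).
    exact: scaled_ratio_cvg (@coord_cts i y).
  have near_yi : \forall y' \near y, set_val y' i != 0.
    apply: (@coord_cts i y [set t | t != 0]).
    by apply: open_nbhs_nbhs; split; [exact: open_neq|exact: yi].
  apply: cvg_trans cts; apply: near_eq_cvg.
  apply: filterS near_yi => y' y'i.
  by rewrite (hedgehog_funE x (hedgehog_supp y'i)).
have y0E i : set_val y i = 0.
  by apply/eqP/negPn/negP => yi; apply: y0; exists i.
have f0 : hedgehog_fun (x, y) = 0.
  by rewrite /hedgehog_fun /=; case: pselect => // -[i]; rewrite y0E eqxx.
rewrite /continuous_at f0.
apply/cvgrPdist_lt => eps eps0.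
have [N _ HN] := near_infty_natSinv_lt (PosNum eps0).
have /filter_forall : forall n : 'I_N, \forall y' \near y,
    forall j, u n j x != 0 ->
      `|n.+1%:R^-1 * ratio (set_val y' (nat_of_ord n, j)) (u n j x)| < eps.
  move=> n; have [[j uj]|u0] := pselect (exists j, u n j x != 0); last first.
    by apply: (@nearW _ (nbhs y)) => y' j uj; exfalso; apply: u0; exists j.
  have /cvgrPdist_lt/(_ _ eps0) : (fun y' : set_type H => n.+1%:R^-1 *
      ratio (set_val y' (nat_of_ord n, j)) (u n j x)) y' @[y' --> y] --> (0 : R).
    have := scaled_ratio_cvg (c := n.+1%:R^-1) (t := u n j x)
      (@coord_cts (nat_of_ord n, j) y).
    by rewrite y0E ratioC ratio0 mulr0.
  apply: filterS => y' + k uk; rewrite -(u_disjoint uj uk).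
  by rewrite sub0r normrN.
apply: filterS => y' Hy'; rewrite sub0r normrN.
have [[[n j] yi]|y'0] := pselect (exists i, set_val y' i != 0); last first.
  by rewrite /hedgehog_fun /=; case: pselect => // _; rewrite normr0.
rewrite (hedgehog_funE x (hedgehog_supp yi)) /=.
have [nN|Nn] := ltnP n N.
  have [->|uj] := eqVneq (u n j x) 0; first by rewrite ratio0 mulr0 normr0.
  exact: (Hy' (Ordinal nN) j uj).
rewrite normrM; apply: (@le_lt_trans _ _ n.+1%:R^-1); last exact: HN.
by rewrite gtr0_norm ?invr_gt0// ler_piMr// ?invr_ge0// ratio_le1.
Qed.

Lemma hedgehog_fun_separately_continuous : separately_continuous hedgehog_fun.
Proof. by split; [exact: hedgehog_fun_cts1|exact: hedgehog_fun_cts2]. Qed.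

(** Near [x] there are points [x'] and indices [j] with [u n j x' != 0]; at the
point [y] of the spike [(n, j)] at height [u n j x'], the value of the function
is [1 / (2 * (n + 1))]. Such a [y] can be taken close to 0: a neighbourhood of 0
restricts only finitely many spikes, on which [u n j x'] is small because
[u n j x = 0]. *)
Lemma hedgehog_fun_discontinuous (n : nat) (x : T) :
  (forall j, u n j x = 0) ->
  (forall V, nbhs x V -> exists j, exists2 x', V x' & u n j x' != 0) ->
  exists y, ~ {for (x, y), continuous hedgehog_fun}.
Proof.
move=> ux0 dense_u.
have H0 : H (fun=> 0).
  by split => [i|i k _]; rewrite ?mulr0// lexx ler01.
pose y0 : set_type H := exist _ (fun=> 0) (mem_set H0).
exists y0 => /cvgrPdist_lt.
have fx0 : hedgehog_fun (x, y0) = 0.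
  by rewrite /hedgehog_fun /=; case: pselect => // -[i]; rewrite eqxx.
rewrite fx0 => /(_ (n.+1%:R^-1 * (1 / 2))).
case; first by rewrite mulr_gt0// ?invr_gt0// divr_gt0.
move=> [V W] /= [Vx]; rewrite {1}/nbhs /= => -[_ [[W' oW' <-] /= W'0] W'W] VW.
have [A [r [r0 AW']]] : exists (A : {fset idx}) (r : R), 0 < r /\
    forall q : cube, (forall i, i \in A -> ball (0 : R) r (q i)) -> W' q.
  apply: (@nbhs_prod_ball R idx (fun=> R : pseudoMetricType R) (fun=> 0)).
  by apply: open_nbhs_nbhs; split.
have Unbhs : nbhs x (V `&` \bigcap_(i in [set` A])
    [set x' | i.1 = n -> u i.1 i.2 x' < r]).
  apply: filterI => //; apply: filter_bigI => i _.
  have [i1|ni1] := eqVneq i.1 n; last first.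
    by apply: nearW => x' /= /eqP; rewrite (negbTE ni1).
  apply: filterS (_ : nbhs x [set x' | u i.1 i.2 x' < r]) => [x' ? _//|].
  apply: (@u_cts i.1 i.2 x [set t | t < r]).
  by apply: open_nbhs_nbhs; split; [exact: open_lt|rewrite /= i1 ux0].
have [j [x' [Vx' Ux'] ux']] := dense_u _ Unbhs.
have [y yE] : exists y : set_type H, set_val y = spike_fun (n, j) (u n j x').
  have Hy : H (spike_fun (n, j) (u n j x')) by exact: spike_hedgehog.
  by exists (exist _ (spike_fun (n, j) (u n j x')) (mem_set Hy)).
have Wy : W y.
  apply: W'W => /=; rewrite yE; apply: AW' => i iA.
  rewrite /ball /= sub0r normrN /spike_fun; case: eqP => [ij|_]; last first.
    by rewrite normr0.
  rewrite ger0_norm; last by have /andP[] := u01 n j x'.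
  by have := Ux' i iA; rewrite ij /=; exact.
have := VW (x', y) (conj Vx' Wy); rewrite /= (@hedgehog_funE x' y (n, j)).
  rewrite yE /spike_fun eqxx /= ratio_diag// sub0r normrN gtr0_norm.
    by rewrite ltxx.
  by rewrite mulr_gt0// ?invr_gt0// divr_gt0.
by move=> k kj; rewrite yE /spike_fun (negbTE kj).
Qed.

End HedgehogFunction.

(** Maximal families with disjoint supports replace a single continuous function
vanishing exactly on a nowhere dense set containing [F n], which need not exist
in an uncountable product. *)
Lemma meager_discontinuities (R : realType) (T : topologicalType)
    (F : nat -> set T) :
  completely_regular_space T -> (forall n, nowhere_dense (F n)) ->
  exists Y : topologicalType, exists f : T * Y -> R,
    [/\ compact_space Y, separately_continuous f &
      forall x, (\bigcup_n F n) x -> exists y, ~ {for (x, y), continuous f}].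
Proof.
move=> crT F0.
pose J : choiceType := {classic (T -> R)}.
pose supp (v : J) := [set x | v x != 0].
pose D n := [set v : J | [/\ continuous v, forall x, 0 <= v x <= 1 &
  forall x, F n x -> v x = 0]].
have /choice[E EP] : forall n,
    exists E, maximal_disjoint_subcollection supp E (D n).
  move=> n; have [E ?] := ex_maximal_disjoint_subcollection supp (D n).
  by exists E.
(* Each function of the family is its own index; other indices give 0. *)
pose u n (v : J) : T -> R := if `[< E n v >] then v else cst 0.
have uP n v : D n (u n v).
  rewrite /u; case: asboolP => [Ev|_]; first by have [+ _ _] := EP n; apply.
  by split => // [x|x]; [exact: cvg_cst|rewrite lexx ler01].
have u_cts n v : continuous (u n v) by have [] := uP n v.
have u01 n v x : 0 <= u n v x <= 1 by have [_ + _] := uP n v; apply.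
have u_disjoint n v v' x : u n v x != 0 -> u n v' x != 0 -> v = v'.
  rewrite /u; case: asboolP => [Ev|_]; last by rewrite eqxx.
  case: asboolP => [Ev'|_]; last by rewrite eqxx.
  by move=> vx v'x; have [_ tE _] := EP n; apply: tE => //; exists x.
exists (set_type (@hedgehog R (nat * J)%type)), (hedgehog_fun u); split.
- apply: compact_compact_space; apply: compact_set_type.
  exact: hedgehog_compact.
- exact: hedgehog_fun_separately_continuous.
move=> x [n _ Fx]; apply: (hedgehog_fun_discontinuous u_cts u01 (n := n)).
  by move=> v; have [_ _] := uP n v; apply.
move=> V; rewrite nbhsE => -[W [oW Wx] WV].
have W0 : W !=set0 by exists x.
have [W' oW' [[z W'z] W'W W'F]] := (nowhere_denseP _).1 (F0 n) W oW W0.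
suff [v Ev [x' [W'x' vx']]] : exists2 v, E n v & W' `&` supp v !=set0.
  exists v; exists x'; first by apply: WV; exact: W'W.
  by rewrite /u asboolT.
apply: maximal_disjoint_dense (EP n) _.
have [] := (@uniform_separatorP _ R [set z] (~` W')).1 _.
  by apply: crT; [exact: open_closedC|apply].
move=> g [cg g01 gz gW'].
have gW'1 x' : ~ W' x' -> g x' = 1 by move=> nW; apply: gW'; exists x'.
exists (fun x' => 1 - g x'); split.
- split.
  + by move=> x'; apply: cvgB; [exact: cvg_cst|exact: cg].
  + move=> x'; have : `[0, 1]%classic (g x') by apply: g01; exists x'.
    by rewrite /= in_itv /=; lra.
  + move=> x' Fx'; rewrite gW'1 ?subrr// => W'x'.
    by suff : set0 x' by []; rewrite -W'F.
- exists z; rewrite /supp /= (_ : g z = 0) ?subr0 ?oner_neq0//.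
  by apply: gz; exists z.
- move=> x'; rewrite /supp /= => gx'; apply: contrapT => /gW'1 gx1.
  by move: gx'; rewrite gx1 subrr eqxx.
Qed.

(** * Open subspaces of products of pseudo-metric spaces *)

Section OpenEmbedding.
Context {R : realType} {I : choiceType} (M : I -> pseudoMetricType R).
Local Notation Q := (prod_topology (fun i => M i : topologicalType)).
Context {T : topologicalType} (e : T -> Q).
Hypothesis e_inj : injective e.
Hypothesis e_open : forall V : set T, open V -> open (e @` V).
Hypothesis e_cts : continuous e.

Lemma open_embedding_completely_regular : completely_regular_space T.
Proof.
move=> a B cB nBa; apply/(@uniform_separatorP _ R).
have oeB : open (e @` (~` B)) by apply: e_open; exact: closed_openC.
have [] := (@uniform_separatorP _ R [set e a] (~` (e @` (~` B)))).1 _.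
  apply: (@uniform_completely_regular R
    (prod_topology (fun i => M i : uniformType))).
    exact: open_closedC.
  by apply; exists a.
move=> g [cg g01 ga gB]; exists (g \o e); split.
- by move=> x; apply: continuous_comp; [exact: e_cts|exact: cg].
- by move=> _ [x _ <-]; apply: g01; exists (e x).
- by move=> _ [x -> <-]; apply: ga; exists (e a).
- move=> _ [x Bx <-]; apply: gB; exists (e x) => //.
  by move=> [x' nBx' /e_inj xx']; apply: nBx'; rewrite xx'.
Qed.

Definition continuity_points (Y : topologicalType) (f : T * Y -> R) : set T :=
  [set x | forall y, {for (x, y), continuous f}].

(** Joint continuity holds where all oscillations are small, off a countable
union of meager sets. *)
Lemma discontinuities_meager (Y : topologicalType) (f : T * Y -> R) :
  compact_space Y -> separately_continuous f ->
  meager (~` continuity_points f).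
Proof.
move=> /compact_space_compact cY scf.
apply: (@sub_meager _ _ (\bigcup_k ~` small_osc f k.+1%:R^-1)).
  move=> x; apply: contra_notP => nU y; apply: small_osc_continuous => // k.
  by apply: contrapT => nk; apply: nU; exists k.
apply: bigcup_meager => k; apply:
  not_small_osc_meager e_inj e_open e_cts cY scf _ _.
by rewrite invr_gt0.
Qed.

Lemma Baire_N_space : Baire_space T <-> N_space R T.
Proof.
split=> [BT Y cY f scf|NT W oW [x Wx] [F F0 WF]].
  exists (continuity_points f) => [W W0 oW|x y]; last exact.
  apply/set0P/eqP => Wf; apply: (BT W oW W0).
  apply: sub_meager (discontinuities_meager cY scf).
  exact/disjoints_subset.
have [Y [f [cY scf fF]]] :=
  meager_discontinuities R open_embedding_completely_regular F0.
have [D dD fD] := NT Y cY f scf.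
have [x' [Wx' Dx']] := dD W (ex_intro _ x Wx) oW.
by have [|y] := fF x'; [rewrite -WF|apply; exact: fD].
Qed.

Lemma nonmeager_gN_space : ~ meager [set: T] <-> gN_space R T.
Proof.
split=> [nm Y cY f scf|gT [F F0 TF]].
  apply: contrapT => h; apply: nm.
  apply: sub_meager (discontinuities_meager cY scf) => x _ fx.
  by apply: h; exists x.
have [Y [f [cY scf fF]]] :=
  meager_discontinuities R open_embedding_completely_regular F0.
have [x fx] := gT Y cY f scf.
by have [|y] := fF x; [rewrite -TF|apply; exact: fx].
Qed.

End OpenEmbedding.

(* The open subspace is the type [set_type X] with its subspace topology. *)
Theorem theorem7p8 (R : realType) (P : topologicalType) (X : set P)
    (hP : Pi_pseudo_metric_space R P) (hX : open X) :
  (Baire_space (set_type X) <-> N_space R (set_type X)) /\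
  (~ meager [set: set_type X] <-> gN_space R (set_type X)).
Proof.
have [I [M [g [g' [gK g'K g_cts g'_cts]]]]] := hP.
pose e : set_type X ->
    prod_topology (I := {classic I}) (fun i => M i : topologicalType) :=
  fun x => g (set_val x).
have e_inj : injective e by move=> x y /(can_inj gK) /val_inj.
have e_cts : continuous e.
  by move=> x; apply: continuous_comp; [exact: initial_continuous|exact: g_cts].
have e_open V : open V -> open (e @` V).
  move=> [W oW <-].
  have -> : e @` (set_val @^-1` W) = g' @^-1` (W `&` X).
    apply/seteqP; split=> q.
      by move=> [x Wx <-]; rewrite /e /= gK; split => //; exact: set_valP.
    move=> [/= Wq Xq]; exists (exist _ (g' q) (mem_set Xq)) => //.
    by rewrite /e /= set_valE /= g'K.
  by apply: open_comp => [q _|]; [exact: g'_cts|exact: openI].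
split; first exact: (Baire_N_space e_inj e_open e_cts).
exact: (nonmeager_gN_space e_inj e_open e_cts).
Qed.
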